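(* Let $\mu$ be a finite Borel measure on $\mathbb{R}$ that is continuous (has no atoms). Let $m>\varsigma\ge0$ be real numbers and assume that $$\liminf_{\epsilon\to0+}\epsilon^{-\varsigma}J_{\mu,m}(x,\epsilon)>0$$ for $\mu$-almost every $x$. Then $$\dim_P^+(\mu)\le\frac{m\varsigma}{m-\varsigma}.$$ If moreover there is $\delta>0$ such that $\gamma_\mu^-(x)\ge\delta$ for $\mu$-almost every $x$, then $$\dim_P^+(\mu)\le\frac{\varsigma(m-\delta)}{m-\varsigma}.$$
   Context: For $m>0$, $x\in\mathbb{R}$, $\epsilon>0$, the $m$-Borel transform of $\mu$ is $J_{\mu,m}(x,\epsilon)=\epsilon^m\int_{\mathbb{R}}\frac{d\mu(y)}{|x-y|^m+\epsilon^m}$. For $x\in\mathrm{supp}\,\mu$, $\gamma_\mu^-(x)=\liminf_{\epsilon\to0+}\frac{\log\mu([x-\epsilon,x+\epsilon])}{\log\epsilon}$. For a Borel set $S\subset\mathbb{R}$, $\dim_P(S)$ is its packing dimension; the upper packing dimension of $\mu$ is $\dim_P^+(\mu)=\inf\{\dim_P(S): S\text{ Borel},\ \mu(S)=\mu(\mathbb{R})\}$.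
   Formalization: In the second part the measure μ is assumed nonzero: for μ = 0 every hypothesis holds vacuously, dim_P^+(μ) = 0, and the bound ς(m−δ)/(m−ς) is negative when δ > m and ς > 0. *)

(* Defs.v *)
From HB Require Import structures.
From mathcomp Require Import all_boot all_order all_algebra.
From mathcomp Require Import all_classical all_reals all_analysis.
Set Implicit Arguments.
Unset Strict Implicit.
Unset Printing Implicit Defensive.
Import Order.TTheory GRing.Theory Num.Theory.
Import numFieldNormedType.Exports.
Local Open Scope classical_set_scope.
Local Open Scope ring_scope.

(* The integral is taken in the extended reals; for a finite measure and
   m, eps > 0 the integrand is bounded by eps^(-m), so the value is finite. *)
Definition borel_transform (R : realType)
    (mu : {measure set (measurableTypeR R) -> \bar R}) (m x eps : R) : \bar R :=
  ((eps `^ m)%:E *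
   \int[mu]_(y in [set: R]) ((`|x - y| `^ m + eps `^ m)^-1)%:E)%E.

Definition measure_support (R : realType)
    (mu : {measure set (measurableTypeR R) -> \bar R}) : set R :=
  [set x | forall U : set R, open U -> U x -> (0 < mu U)%E].

(* Only meaningful for x in the support of a finite measure, where the
   argument of the logarithm is a positive real. *)
Definition lower_local_dim (R : realType)
    (mu : {measure set (measurableTypeR R) -> \bar R}) (x : R) : \bar R :=
  limf_einf
    (fun eps : R => (ln (fine (mu `[x - eps, x + eps]%classic)) / ln eps)%:E)
    0^'+.

(* The pairwise disjoint closed balls [x i - r i, x i + r i], i in D, of
   diameter at most d and with centres in S; D may be finite or infinite. *)
Definition is_packing (R : realType) (S : set R) (d : R)
    (D : set nat) (x r : nat -> R) : Prop :=
  (forall i, D i -> [/\ S (x i), 0 < r i & 2 * r i <= d]) /\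
  trivIset D (fun i => `[x i - r i, x i + r i]%classic).

Definition packing_sup (R : realType) (s d : R) (S : set R) : \bar R :=
  ereal_sup [set e | exists (D : set nat) (x r : nat -> R),
    is_packing S d D x r /\ e = (\esum_(i in D) ((2 * r i) `^ s)%:E)%E].

(* packing_sup is nondecreasing in d, so the infimum is the limit as d -> 0+. *)
Definition packing_premeasure (R : realType) (s : R) (S : set R) : \bar R :=
  ereal_inf [set packing_sup s d S | d in [set d : R | 0 < d]].

(* The premeasure is not countably subadditive; the packing measure is the
   outer measure obtained from it by countable covers. *)
Definition packing_measure (R : realType) (s : R) (S : set R) : \bar R :=
  ereal_inf [set e | exists F : nat -> set R,
    S `<=` \bigcup_i F i /\
    e = (\sum_(0 <= i <oo) packing_premeasure s (F i))%E].

(* With s ranging over s >= 0, the empty set has dimension 0. *)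
Definition packing_dim (R : realType) (S : set R) : \bar R :=
  ereal_inf [set s%:E | s in [set s : R | 0 <= s /\ packing_measure s S = 0%E]].

Definition upper_packing_dim (R : realType)
    (mu : {measure set (measurableTypeR R) -> \bar R}) : \bar R :=
  ereal_inf [set packing_dim S | S in
    [set S : set (measurableTypeR R) | measurable S /\ mu S = mu setT]].

(* Main.v *)
(* Suppose mu [x - r, x + r] <= A r^a for all r > 0, with a < m. Summing over
   dyadic annuli gives J(x, eps) <= mu [x - r, x + r] + C eps^m r^(a - m). When
   J(x, eps) >= c eps^sigma for small eps, the choice of eps proportional to
   r^((m - a) / (m - sigma)) makes the last term at most (c / 2) eps^sigma, so
   that mu [x - r, x + r] >= c' r^s with s = sigma (m - a) / (m - sigma). Such a
   bound at almost every x forces the upper packing dimension to be at most s: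
   on the set where it holds uniformly, packings have bounded s-sums because
   disjoint balls have total mass at most that of mu. A finite measure allows
   a = 0, and lower local dimension at least delta allows every a < delta. *)
Require Import Defs.
From HB Require Import structures.
From mathcomp Require Import all_boot all_order all_algebra.
From mathcomp Require Import all_classical all_reals all_analysis.
From mathcomp Require Import measurable_realfun.
From mathcomp Require Import ring lra.
Set Implicit Arguments.
Unset Strict Implicit.
Unset Printing Implicit Defensive.
Import Order.TTheory GRing.Theory Num.Theory.
Import numFieldNormedType.Exports.
Local Open Scope classical_set_scope.
Local Open Scope ring_scope.

(** * Limits at 0+, real powers, geometric series and dyadic scales *)

Lemma near_right0P (R : realType) (P : R -> Prop) :
  (\forall e \near 0^'+, P e) <-> exists2 d : R, 0 < d & forall e, 0 < e < d -> P e.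
Proof.
split=> [[d /= d0 dP]|[d d0 dP]].
  exists d => // e /andP[e0 ed]; apply: dP => //=.
  by rewrite sub0r normrN gtr0_norm.
near=> e; apply: dP; apply/andP; split; near: e.
  exact: nbhs_right_gt.
exact: nbhs_right_lt.
Unshelve. all: by end_near. Qed.

Lemma lt_limf_einf (R : realType) (T : choiceType) (X : filteredType T)
    (f : X -> \bar R) (F : set_system X) (c : \bar R) {FF : Filter F} :
  (c < limf_einf f F)%E -> \forall x \near F, (c < f x)%E.
Proof.
rewrite limf_einfE => /ereal_sup_gt[_ [V FV <-] cV].
apply: filterS FV => x Vx; apply: lt_le_trans cV _.
by apply: ereal_inf_lbound; exists x.
Qed.

(** Used to pick a scale at which a positive power takes a prescribed value. *)
Lemma powR_surj (R : realType) (p y : R) : 0 < p -> 0 < y ->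
  exists2 L : R, 0 < L & L `^ p = y.
Proof.
move=> p0 y0; exists (y `^ p^-1); first exact: powR_gt0.
by rewrite -powRrM mulVf ?gt_eqF// powRr1// ltW.
Qed.

Lemma nneseries_geometric_le (R : realType) (u : nat -> \bar R) (C q : R) :
  0 <= C -> 0 <= q < 1 -> (forall n, 0 <= u n)%E ->
  (forall n, u n <= (C * q ^+ n)%:E)%E ->
  (\sum_(0 <= n <oo) u n <= (C / (1 - q))%:E)%E.
Proof.
move=> C0 /andP[q0 q1] u0 uC; apply: lime_le.
  by apply: is_cvg_nneseries => n _ _; exact: u0.
apply: nearW => n; apply: (@le_trans _ _ (series (geometric C q) n)%:E).
  by rewrite /series /= -sumEFin; apply: lee_sum => i _; exact: uC.
rewrite geometric_seriesE ?lt_eqF//= lee_fin ler_pM2r ?invr_gt0 ?subr_gt0//.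
by rewrite ler_piMr// gerBl exprn_ge0.
Qed.


Lemma in_closed_ball (R : realType) (x r y : R) :
  (y \in `[x - r, x + r]) = (`|x - y| <= r).
Proof. by rewrite in_itv/= ler_distlC. Qed.

(** [k] is the predecessor of the least [n] with [t <= 2 ^+ n * r], which is positive because
    [r < t]. *)
Lemma dyadic_scale (R : realType) (r t : R) : 0 < r -> r < t ->
  exists k : nat, 2 ^+ k * r < t <= 2 ^+ k.+1 * r.
Proof.
move=> r0 rt.
have ex : exists n : nat, t <= 2 ^+ n * r.
  exists (Num.bound (t / r)); rewrite -ler_pdivrMr//.
  have tr0 : 0 <= t / r by rewrite divr_ge0// ltW// (lt_trans r0).
  apply/ltW/(lt_le_trans (archi_boundP tr0)).
  by rewrite -natrX ler_nat ltnW// ltn_expl.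
case: (ex_minnP ex) => -[|k]; first by rewrite expr0 mul1r leNgt rt.
move=> tk kmin; exists k; rewrite tk andbT ltNge; apply/negP => /kmin.
by rewrite ltnn.
Qed.

Local Notation cball x r := (`[x - r, x + r]%classic).

Lemma powR2_lt1 (R : realType) (a : R) : a < 0 -> 2 `^ a < 1.
Proof.
move=> a0; rewrite -[ltRHS](powRr0 (2 : R)).
by rewrite /powR (gt_eqF (ltr0n _ 2))// ltr_expR ltr_pM2r// ln_gt0// ltr1n.
Qed.

(** * Upper bound for the Borel transform *)

Section mass.
Context {R : realType} (mu : {finite_measure set (measurableTypeR R) -> \bar R}).

Lemma integral_indicZ (c : R) (B : set R) : 0 <= c -> measurable B ->
  (\int[mu]_(y in [set: R]) (c * \1_B y)%:E = c%:E * mu B)%E.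
Proof.
move=> c0 mB; under eq_integral do rewrite EFinM.
rewrite ge0_integralZl_EFin ?integral_indic ?setIT//.
by apply/measurable_EFinP; exact: measurable_indic.
Qed.

Lemma measurable_borel_kernel (m x eps : R) :
  measurable_fun [set: R] (fun y : R => ((`|x - y| `^ m + eps `^ m)^-1)%:E).
Proof.
apply/measurable_EFinP; rewrite [X in measurable_fun _ X](_ : _ =
    (fun y : R => (`|x - y| `^ m + eps `^ m) `^ (-1))); last first.
  by apply/funext => y; rewrite powR_inv1// addr_ge0// powR_ge0.
apply: (@measurableT_comp _ _ _ _ _ _ (@powR R ^~ (-1))) => //.
apply: measurable_funD => //.
apply: (@measurableT_comp _ _ _ _ _ _ (@powR R ^~ m)) => //.
apply: measurableT_comp => //.
exact: measurable_funB.
Qed.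

(* The kernel is split into the ball of radius r and the dyadic annuli
   2^k r < |x - y| <= 2^(k+1) r, whose contributions form a geometric series. *)
Lemma borel_transform_le (m x eps r A a : R) :
  0 < m -> 0 < eps -> 0 < r -> 0 <= A -> a < m ->
  (forall r' : R, 0 < r' -> (mu (cball x r') <= (A * r' `^ a)%:E)%E) ->
  (borel_transform mu m x eps <= mu (cball x r) +
    (A * 2 `^ a / (1 - 2 `^ (a - m)) * eps `^ m * r `^ (a - m))%:E)%E.
Proof.
move=> m0 eps0 r0 A0 am massA.
have mB r' : measurable (cball x r' : set (measurableTypeR R)).
  exact: measurable_itv.
(* [h0] drops [|x - y| ^ m] from the denominator. [h k] drops [eps ^ m], replaces [|x - y|] by the
   inner radius of the annulus, and enlarges the annulus to the full outer ball. *)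
pose h0 (y : R) := (((eps `^ m)^-1) * \1_(cball x r) y)%:E.
pose h (k : nat) (y : R) := ((((2 ^+ k * r) `^ m)^-1) *
  \1_(cball x (2 ^+ k.+1 * r)) y)%:E.
have h00 y : (0 <= h0 y)%E.
  by rewrite lee_fin mulr_ge0// invr_ge0 powR_ge0.
have hk0 k y : (0 <= h k y)%E.
  by rewrite lee_fin mulr_ge0// invr_ge0 powR_ge0.
have mh0 : measurable_fun [set: R] h0.
  by apply/measurable_EFinP; apply: measurable_funM => //; exact: measurable_indic.
have mh k : measurable_fun [set: R] (h k).
  by apply/measurable_EFinP; apply: measurable_funM => //; exact: measurable_indic.
have e0 : 0 < eps `^ m by exact: powR_gt0.
have kernel_le y : (((`|x - y| `^ m + eps `^ m)^-1)%:E <=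
    h0 y + \sum_(0 <= k <oo) h k y)%E.
  have [xyr|rxy] := leP `|x - y| r.
    apply: (@le_trans _ _ (h0 y)).
      rewrite /h0 lee_fin indicE mem_set/= ?in_closed_ball// mulr1.
      by rewrite lef_pV2 ?posrE ?ltr_wpDl ?powR_ge0// lerDr powR_ge0.
    by rewrite leeDl// nneseries_ge0.
  have [k /andP[kxy xyk]] := dyadic_scale r0 rxy.
  have k0 : 0 < 2 ^+ k * r by rewrite mulr_gt0// exprn_gt0.
  apply: (@le_trans _ _ (h k y)).
    rewrite /h lee_fin indicE mem_set/= ?in_closed_ball// mulr1.
    rewrite lef_pV2 ?posrE ?ltr_wpDl ?powR_ge0 ?powR_gt0//.
    apply: (@le_trans _ _ (`|x - y| `^ m)); last by rewrite lerDl powR_ge0.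
    by rewrite ge0_ler_powR ?nnegrE ?(ltW k0) ?(ltW kxy) ?(ltW m0).
  apply: (@le_trans _ _ (\sum_(0 <= k <oo) h k y)%E); last by rewrite leeDr.
  apply: le_trans (nneseries_lim_ge k.+1 _); last by move=> *; exact: hk0.
  rewrite big_nat_recr//=.
  by rewrite leeDr// sume_ge0.
(* The mass bound at radius [2 ^+ k.+1 * r] makes the [k]-th integral at most
   [A * 2 ^ a * r ^ (a - m)] times the [k]-th power of [2 ^ (a - m)], a ratio below 1 since
   [a < m]. *)
have tail_le : (\sum_(0 <= k <oo) \int[mu]_(y in [set: R]) h k y <=
    (A * 2 `^ a * r `^ (a - m) / (1 - 2 `^ (a - m)))%:E)%E.
  apply: nneseries_geometric_le.
  - by rewrite !mulr_ge0 ?powR_ge0.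
  - by rewrite powR_ge0 powR2_lt1// subr_lt0.
  - by move=> k; apply: integral_ge0 => y _.
  - move=> k; have k0 : 0 < 2 ^+ k * r by rewrite mulr_gt0// exprn_gt0.
    rewrite integral_indicZ ?invr_ge0 ?powR_ge0//.
    apply: (@le_trans _ _ (((2 ^+ k * r) `^ m)^-1%:E *
        (A * (2 ^+ k.+1 * r) `^ a)%:E)%E).
      rewrite lee_wpmul2l ?lee_fin ?invr_ge0 ?powR_ge0//.
      by apply: massA; rewrite mulr_gt0// exprn_gt0.
    have scaleE : r `^ (a - m) * 2 `^ (a - m) ^+ k =
        (2 ^+ k * r) `^ a / (2 ^+ k * r) `^ m.
      rewrite -powRB; last by rewrite (gt_eqF k0) implybT.
      rewrite powRM ?exprn_ge0 ?(ltW r0)// -[2 ^+ k]powR_mulrn// powRAC.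
      by rewrite -powR_mulrn ?powR_ge0// mulrC.
    rewrite -EFinM lee_fin exprS -mulrA [(2 * _) `^ a]powRM ?(ltW k0)//.
    rewrite -[leRHS]mulrA scaleE le_eqVlt; apply/orP; left; apply/eqP.
    ring.
rewrite /borel_transform.
apply: (@le_trans _ _ ((eps `^ m)%:E * \int[mu]_(y in [set: R])
    (h0 y + \sum_(0 <= k <oo) h k y))%E).
  rewrite lee_wpmul2l ?lee_fin ?powR_ge0//; apply: ge0_le_integral => //.
  - by move=> y _; rewrite lee_fin invr_ge0 addr_ge0 ?powR_ge0.
  - exact: measurable_borel_kernel.
  - apply: emeasurable_funD => //.
    by apply: ge0_emeasurable_sum => k *; [exact: hk0|exact: mh].
rewrite ge0_integralD//; last 2 first.
  by move=> y _; exact: nneseries_ge0.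
  by apply: ge0_emeasurable_sum => k *; [exact: hk0|exact: mh].
rewrite integral_nneseries// integral_indicZ ?invr_ge0 ?powR_ge0//.
rewrite ge0_muleDr ?nneseries_ge0//; last 2 first.
- by rewrite mule_ge0// lee_fin invr_ge0 powR_ge0.
- by move=> k _ _; exact: integral_ge0.
rewrite muleA -EFinM divff ?gt_eqF// mul1e leeD2l//.
apply: (le_trans (lee_wpmul2l _ tail_le)); first by rewrite lee_fin powR_ge0.
rewrite -EFinM lee_fin le_eqVlt; apply/orP; left; apply/eqP.
ring.
Qed.

(** * Power bounds for the mass of small balls *)

Lemma ball_mass_lower_bound (m sigma a A x : R) :
  0 <= sigma < m -> a < m -> 0 <= A ->
  (forall r : R, 0 < r -> (mu (cball x r) <= (A * r `^ a)%:E)%E) ->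
  (0 < limf_einf (fun eps : R =>
     (eps `^ (- sigma))%:E * borel_transform mu m x eps) 0^'+)%E ->
  exists2 c' : R, 0 < c' & \forall r \near 0^'+,
    ((c' * r `^ (sigma * (m - a) / (m - sigma)))%:E <= mu (cball x r))%E.
Proof.
move=> /andP[s0 sm] am A0 massA infJ.
(* The lower limit may be [+oo], in which case [c = 1] is taken. *)
have [c /andP[c0 /lt_limf_einf cJ]] : exists c : R, (0 < c) &&
    (c%:E < limf_einf (fun eps : R =>
       (eps `^ (- sigma))%:E * borel_transform mu m x eps) 0^'+)%E.
  move: infJ; set l := limf_einf _ _; case: l => [l|_|//].
    by rewrite lte_fin => l0; exists (l / 2); rewrite lte_fin; lra.
  by exists 1; rewrite ltr01 ltry.
have /near_right0P[e0 e00 Jge] : \forall e \near 0^'+,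
    (c%:E < (e `^ (- sigma))%:E * borel_transform mu m x e)%E by exact: cJ.
have m0 : 0 < m by apply: le_lt_trans sm.
have ms0 : 0 < m - sigma by rewrite subr_gt0.
have ma0 : 0 < m - a by rewrite subr_gt0.
pose C := A * 2 `^ a / (1 - 2 `^ (a - m)).
have C0 : 0 <= C.
  by rewrite divr_ge0 ?mulr_ge0 ?powR_ge0// subr_ge0 ltW// powR2_lt1// subr_lt0.
have C10 : 0 < C + 1 by rewrite ltr_wpDl.
have c20 : 0 < c / 2 by rewrite divr_gt0.
(* This gives [C * L ^ (m - sigma) <= c / 2]; the denominator is [C + 1] because [C] may vanish.
   Below, [d] is chosen so that [r < d] forces [L * r ^ p < e0]. *)
have [L L0 LE] := @powR_surj _ (m - sigma) (c / 2 / (C + 1)) ms0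
  (divr_gt0 c20 C10).
pose p := (m - a) / (m - sigma).
have p0 : 0 < p by rewrite divr_gt0.
have [d d0 dE] := @powR_surj _ p (e0 / L) p0 (divr_gt0 e00 L0).
exists (c / 2 * L `^ sigma); first by rewrite mulr_gt0 ?powR_gt0// divr_gt0.
apply/near_right0P; exists d => // r /andP[r0 rd].
(* At this scale the far part of the transform is at most (c / 2) eps^sigma. *)
pose eps := L * r `^ p.
have eps0 : 0 < eps by rewrite mulr_gt0// powR_gt0.
have epse0 : eps < e0.
  rewrite /eps mulrC -ltr_pdivlMr// -dE gt0_ltr_powR// nnegrE; exact: ltW.
have /Jge : 0 < eps < e0 by rewrite eps0.
have epss0 : 0 < eps `^ sigma by exact: powR_gt0.
have := borel_transform_le m0 eps0 r0 A0 am massA.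
rewrite -/C; have mfin : mu (cball x r) \is a fin_num.
  by apply: fin_num_measure; exact: measurable_itv.
rewrite -(fineK mfin) -EFinD; set M := fine _ => JM {}cJ.
have : (c%:E < (eps `^ (- sigma))%:E *
    (M + C * eps `^ m * r `^ (a - m))%:E)%E.
  by apply: lt_le_trans cJ _; rewrite lee_wpmul2l// lee_fin powR_ge0.
rewrite -EFinM lte_fin lee_fin powRN mulrC ltr_pdivlMr//.
(* Since [p * (m - sigma) = m - a], the factor [r ^ (m - a)] produced here cancels the [r ^ (a - m)]
   of the far part. *)
have epsE : eps `^ m = eps `^ sigma * (c / 2 / (C + 1) * r `^ (m - a)).
  have -> : eps `^ m = eps `^ sigma * eps `^ (m - sigma).
    by rewrite -powRD ?(gt_eqF eps0) ?implybT// addrC subrK.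
  congr *%R; rewrite {1}/eps powRM ?(ltW L0) ?powR_ge0// LE -powRrM.
  by rewrite /p mulfVK// gt_eqF.
have rE : r `^ (m - a) * r `^ (a - m) = 1.
  by rewrite -(opprB a m) powRN mulVf// gt_eqF// powR_gt0.
have -> : C * eps `^ m * r `^ (a - m) =
    eps `^ sigma * (c / 2 / (C + 1) * C) * (r `^ (m - a) * r `^ (a - m)).
  by rewrite epsE; ring.
rewrite rE mulr1 => cM.
have -> : sigma * (m - a) / (m - sigma) = p * sigma by rewrite /p; ring.
have -> : c / 2 * L `^ sigma * r `^ (p * sigma) = c / 2 * eps `^ sigma.
  by rewrite /eps powRM ?(ltW L0) ?powR_ge0// powRrM mulrA.
have Cc : c / 2 / (C + 1) * C <= c / 2.
  rewrite -mulrA ler_piMr ?divr_ge0 ?ltW// mulrC ltr_pdivrMr// mul1r.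
  by rewrite ltrDl.
have : eps `^ sigma * (c / 2 / (C + 1) * C) <= eps `^ sigma * (c / 2).
  by rewrite ler_pM2l.
lra.
Qed.

(** For [r >= d] the total mass is at most [mu setT / d ^ a * r ^ a], because [a >= 0]; smaller
    radii are covered by the hypothesis. *)
Lemma ball_mass_upper_bound (a x : R) : 0 <= a ->
  (\forall r \near 0^'+, (mu (cball x r) <= (r `^ a)%:E)%E) ->
  exists2 A : R, 0 <= A &
    forall r : R, 0 < r -> (mu (cball x r) <= (A * r `^ a)%:E)%E.
Proof.
move=> a0 /near_right0P[d d0 mud].
have Mfin : mu setT \is a fin_num by exact: fin_num_measure.
have M0 : 0 <= fine (mu setT) by exact: fine_ge0.
have da0 : 0 < d `^ a by exact: powR_gt0.
exists (1 + fine (mu setT) / d `^ a).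
  by rewrite addr_ge0// divr_ge0// ltW.
move=> r r0; have [rd|dr] := ltP r d.
  apply: le_trans (mud r _) _; first by rewrite r0.
  by rewrite lee_fin ler_peMl ?powR_ge0// lerDl divr_ge0// ltW.
apply: (@le_trans _ _ (mu setT)).
  by apply: le_measure => //; rewrite inE//; exact: measurable_itv.
rewrite -(fineK Mfin) lee_fin mulrDl mul1r ler_wpDl ?powR_ge0//.
rewrite -mulrA ler_peMr// mulrC ler_pdivlMr// mul1r.
by rewrite ge0_ler_powR// nnegrE ltW.
Qed.

Lemma lower_local_dim_mass (a x : R) (delta : \bar R) : (a%:E < delta)%E ->
  (delta <= lower_local_dim mu x)%E ->
  \forall r \near 0^'+, (mu (cball x r) <= (r `^ a)%:E)%E.
Proof.
move=> /lt_le_trans ad /ad /lt_limf_einf H.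
have {}H : \forall r \near 0^'+, (a%:E < (ln (fine (mu (cball x r))) / ln r)%:E)%E.
  exact: H.
near=> r.
have r0 : 0 < r by near: r; exact: nbhs_right_gt.
have r1 : r < 1 by near: r; exact: nbhs_right_lt.
have : (a%:E < (ln (fine (mu (cball x r))) / ln r)%:E)%E by near: r.
have mfin : mu (cball x r) \is a fin_num.
  by apply: fin_num_measure; exact: measurable_itv.
(* As [r < 1], [ln r] is negative and clearing it reverses the inequality. Balls of mass zero are
   then treated apart, before comparing logarithms. *)
rewrite lte_fin ltr_ndivlMr ?ln_lt0 ?r0// -ln_powR -(fineK mfin) lee_fin.
have : 0 <= fine (mu (cball x r)) by exact: fine_ge0.
rewrite le_eqVlt => /predU1P[<- _|M0]; first exact: powR_ge0.
by rewrite ltr_ln ?posrE ?powR_gt0// => /ltW.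
Unshelve. all: by end_near. Qed.

(** Every neighbourhood of [x] contains a small ball of positive mass. This makes a hypothesis on
    the local dimension, stated on the support only, available at such points. *)
Lemma mem_measure_support (c s x : R) : 0 < c ->
  (\forall r \near 0^'+, ((c * r `^ s)%:E <= mu (cball x r))%E) ->
  measure_support mu x.
Proof.
move=> c0 cmu U oU Ux.
have [r [[r0 cr] rU]] : exists r, (0 < r /\ ((c * r `^ s)%:E <= mu (cball x r))%E)
    /\ cball x r `<=` U.
  apply: (@filter_ex _ (0^'+ : set_system R)); near=> r; split.
    by split; near: r => //; exact: nbhs_right_gt.
  by near: r; exact: open_itvcc_subset.
apply: (@lt_le_trans _ _ (c * r `^ s)%:E).
  by rewrite lte_fin mulr_gt0// powR_gt0.
apply: (le_trans cr); apply: le_measure => //; rewrite inE.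
  exact: measurable_itv.
exact: open_measurable.
Unshelve. all: by end_near. Qed.

(** If [s < a], the two bounds give [c <= A * r ^ (a - s)], which fails as [r] tends to 0. *)
Lemma ball_mass_exponent_le (c s A a x : R) : 0 < c -> 0 <= A ->
  (\forall r \near 0^'+, ((c * r `^ s)%:E <= mu (cball x r))%E) ->
  (forall r : R, 0 < r -> (mu (cball x r) <= (A * r `^ a)%:E)%E) -> a <= s.
Proof.
move=> c0 A0 cmu muA; rewrite leNgt; apply/negP => sa.
have as0 : 0 < a - s by rewrite subr_gt0.
have A10 : 0 < A + 1 by rewrite ltr_wpDl.
have [d d0 dE] := @powR_surj _ (a - s) (c / (A + 1)) as0 (divr_gt0 c0 A10).
have [r [r0 rd cr]] : exists r, [/\ 0 < r, r < d &
    ((c * r `^ s)%:E <= mu (cball x r))%E].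
  apply: (@filter_ex _ (0^'+ : set_system R)); near=> r; split.
  - by near: r; exact: nbhs_right_gt.
  - by near: r; exact: nbhs_right_lt.
  - by near: r.
have rs0 : 0 < r `^ s by exact: powR_gt0.
have := le_trans cr (muA r r0); rewrite lee_fin.
rewrite -(subrK s a) [r `^ (_ + _)]powRD; last by rewrite (gt_eqF r0) implybT.
rewrite mulrA ler_pM2r// leNgt => /negP; apply.
have : r `^ (a - s) < c / (A + 1).
  by rewrite -dE gt0_ltr_powR// nnegrE ltW.
rewrite ltr_pdivlMr//; apply: le_lt_trans.
by rewrite [leRHS]mulrC ler_wpM2r ?powR_ge0// lerDl.
Unshelve. all: by end_near. Qed.

(** * From lower mass bounds to packing dimension *)

Lemma packing_sup_ge0 (s d : R) (S : set R) : (0 <= packing_sup s d S)%E.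
Proof.
apply: ereal_sup_ubound; exists set0, (fun=> 0), (fun=> 0); split.
  by split=> // i j [].
by rewrite esum_set0.
Qed.

Lemma packing_premeasure_ge0 (s : R) (S : set R) : (0 <= packing_premeasure s S)%E.
Proof. by apply: le_ereal_inf_tmp => _ [d _ <-]; exact: packing_sup_ge0. Qed.

(** Each ball of a packing satisfies [(2 * r) ^ t <= d ^ (t - s) * (2 ^ s / c) * mu (cball x r)].
    Disjointness bounds the sum by [d ^ (t - s)] times a constant, which tends to 0 with [d]. *)
Lemma packing_premeasure_eq0 (s t c d0 : R) (S : set R) :
  0 <= s < t -> 0 < c -> 0 < d0 ->
  (forall x r : R, S x -> 0 < r < d0 -> ((c * r `^ s)%:E <= mu (cball x r))%E) ->
  packing_premeasure t S = 0%E.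
Proof.
move=> /andP[s0 st] c0 d00 muS.
have ts0 : 0 < t - s by rewrite subr_gt0.
have Mfin : mu setT \is a fin_num by exact: fin_num_measure.
have M0 : 0 <= fine (mu setT) by exact: fine_ge0.
have c20 : 0 < 2 `^ s / c by rewrite divr_gt0// powR_gt0.
have mB x r : measurable (cball x r : set (measurableTypeR R)).
  exact: measurable_itv.
have sup_le d : 0 < d -> d <= d0 ->
    (packing_sup t d S <= (d `^ (t - s) * (2 `^ s / c) * fine (mu setT))%:E)%E.
  move=> d_gt0 dd0; apply: ge_ereal_sup => _ [D [x [r [[Dxr Dtriv] ->]]]].
  apply: ge_ereal_sup => _ [F [finF FD] <-].
  apply: (@le_trans _ _ (\sum_(i \in F)
      ((d `^ (t - s) * (2 `^ s / c))%:E * mu (cball (x i) (r i))))%E).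
    apply: lee_fsum => // i Fi; have [Sxi ri0 rid] := Dxr _ (FD _ Fi).
    have ri20 : 0 < 2 * r i by rewrite mulr_gt0.
    have rid0 : r i < d0 by lra.
    apply: (@le_trans _ _ ((d `^ (t - s) * (2 `^ s / c))%:E *
        (c * r i `^ s)%:E)%E); last first.
      apply: lee_wpmul2l; first by rewrite lee_fin mulr_ge0 ?powR_ge0 ?(ltW c20).
      by apply: muS; rewrite ?ri0.
    have -> : (2 * r i) `^ t = (2 * r i) `^ (t - s) * (2 * r i) `^ s.
      by rewrite -powRD ?subrK// (gt_eqF ri20) implybT.
    rewrite -EFinM lee_fin [X in _ * X <= _]powRM ?(ltW ri0)//.
    rewrite -[leRHS]mulrA [2 `^ s / c * _]mulrA mulfVK ?gt_eqF//.
    rewrite ler_wpM2r ?mulr_ge0 ?powR_ge0//.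
    by rewrite ge0_ler_powR ?nnegrE// ltW.
  rewrite -ge0_mule_fsumr// -(measure_fin_bigcup mu finF)//; last first.
    exact: sub_trivIset Dtriv.
  rewrite [leRHS]EFinM fineK//; apply: lee_wpmul2l.
    by rewrite lee_fin mulr_ge0 ?powR_ge0 ?(ltW c20).
  apply: le_measure; rewrite ?inE//.
  exact: fin_bigcup_measurable.
apply/eqP; rewrite eq_le packing_premeasure_ge0 andbT.
apply/lee_addgt0Pr => e e0; rewrite add0e.
pose K := 2 `^ s / c * fine (mu setT).
have K0 : 0 <= K by rewrite mulr_ge0// ltW.
have K10 : 0 < K + 1 by rewrite ltr_wpDl.
(* Chosen so that [d ^ (t - s) * K <= e], also when [K = 0]. *)
have [d d_gt0 dE] := @powR_surj _ (t - s) (e / (K + 1)) ts0 (divr_gt0 e0 K10).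
pose d' := Num.min d d0.
have d'0 : 0 < d' by rewrite lt_min d_gt0.
apply: (@le_trans _ _ (packing_sup t d' S)).
  by apply: ereal_inf_lbound; exists d'.
apply: le_trans (sup_le _ d'0 _) _; first by rewrite ge_min lexx orbT.
rewrite lee_fin -mulrA -/K; apply: (@le_trans _ _ (d `^ (t - s) * K)).
  rewrite ler_wpM2r// ge0_ler_powR ?nnegrE ?(ltW d'0) ?(ltW d_gt0) ?(ltW ts0)//.
  by rewrite ge_min lexx.
by rewrite dE mulrAC ler_pdivrMr// ler_pM2l// lerDl.
Qed.

(** The constant and the range of radii depend on the point, so [S] is covered by countably many
    sets on which both are uniform; each has zero premeasure in every dimension [s + e]. *)
Lemma packing_dim_le (s : R) (S : set R) : 0 <= s ->
  (forall x, S x -> exists2 c : R, 0 < c &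
    \forall r \near 0^'+, ((c * r `^ s)%:E <= mu (cball x r))%E) ->
  (packing_dim S <= s%:E)%E.
Proof.
move=> s0 muS; apply/lee_addgt0Pr => e e0; rewrite -EFinD.
apply: ereal_inf_lbound; exists (s + e) => //; split; first by rewrite addr_ge0// ltW.
(* One index serves both as mass constant and as bound on the radii. *)
pose F (n : nat) := [set x : R | forall r : R, 0 < r < n.+1%:R^-1 ->
  ((n.+1%:R^-1 * r `^ s)%:E <= mu (cball x r))%E].
apply/eqP; rewrite eq_le; apply/andP; split; last first.
  apply: le_ereal_inf_tmp => _ [G [_ ->]].
  by apply: nneseries_ge0 => n _ _; exact: packing_premeasure_ge0.
apply: ereal_inf_lbound; exists F; split; last first.
  rewrite eseries0// => n _ _.
  apply: (@packing_premeasure_eq0 s _ n.+1%:R^-1 n.+1%:R^-1) => //.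
    by rewrite s0 ltrDl.
  by move=> x r; exact.
move=> x /muS[c c0 /near_right0P[d d0 cmu]].
have cd0 : 0 < Num.min c d by rewrite lt_min c0.
pose n := Num.bound (Num.min c d)^-1.
have nle : n.+1%:R^-1 <= Num.min c d.
  rewrite -[leRHS]invrK lef_pV2 ?posrE ?invr_gt0//.
  apply/ltW/(lt_le_trans (archi_boundP _)); first by rewrite invr_ge0 ltW.
  by rewrite ler_nat.
move: nle; rewrite le_min => /andP[nc nd].
exists n => // r /andP[r0 rn]; apply: le_trans (cmu r _).
  by rewrite lee_fin ler_wpM2r// powR_ge0.
by rewrite r0 (lt_le_trans rn).
Qed.

(** The complement of a measurable null set containing the exceptional points is a Borel set of full
    mass. *)
Lemma upper_packing_dim_le (s : R) : 0 <= s ->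
  {ae mu, forall x : R, exists2 c : R, 0 < c &
    \forall r \near 0^'+, ((c * r `^ s)%:E <= mu (cball x r))%E} ->
  (upper_packing_dim mu <= s%:E)%E.
Proof.
move=> s0 [N [mN muN0 subN]].
apply: (@le_trans _ _ (packing_dim (~` N))).
  apply: ereal_inf_lbound; exists (~` N) => //; split; first exact: measurableC.
  have mNC : measurable (~` N : set (measurableTypeR R)) by exact: measurableC.
  have muUC : mu (N `|` ~` N) = (mu N + mu (~` N))%E.
    exact: measureU mN mNC (setICr N).
  have muN : mu N = 0%E by exact: muN0.
  by rewrite setUv muN add0e in muUC.
apply: packing_dim_le => // x Nx; apply: contrapT => Px.
by apply: Nx; exact: subN.
Qed.

End mass.

(** * The two dimension bounds *)

Unset Implicit Arguments.

Theorem corollary1p4 (R : realType)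
    (mu : {finite_measure set (measurableTypeR R) -> \bar R})
    (mu_continuous : forall x : R, mu [set x] = 0%E)
    (m sigma : R) (sigma_ge0 : 0 <= sigma) (sigma_lt_m : sigma < m)
    (mu_liminf : {ae mu, forall x : R,
       (0 < limf_einf (fun eps : R =>
              (eps `^ (- sigma))%:E * borel_transform mu m x eps)
              0^'+)%E}) :
  (upper_packing_dim mu <= (m * sigma / (m - sigma))%:E)%E /\
  (* The bound below may be negative when mu = 0, whose upper packing
     dimension is 0, so this part needs mu to be nonzero. *)
  (mu [set: R] != 0%E ->
   forall delta : R, 0 < delta ->
   {ae mu, forall x : R, measure_support mu x ->
      (delta%:E <= lower_local_dim mu x)%E} ->
   (upper_packing_dim mu <= (sigma * (m - delta) / (m - sigma))%:E)%E).
Proof.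
have m0 : 0 < m by apply: le_lt_trans sigma_lt_m.
have ms0 : 0 < m - sigma by rewrite subr_gt0.
have ssm : 0 <= sigma < m by rewrite sigma_ge0.
have bound_ge0 a : a < m -> 0 <= sigma * (m - a) / (m - sigma).
  by move=> am; rewrite divr_ge0 ?mulr_ge0 ?subr_ge0// ltW.
have aeF : Filter (almost_everywhere mu) := ae_filter_ringOfSetsType mu.
(* The case [a = 0], with the total mass as constant [A]. *)
have masses : {ae mu, forall x : R, exists2 c : R, 0 < c &
    \forall r \near 0^'+,
      ((c * r `^ (sigma * (m - 0) / (m - sigma)))%:E <= mu (cball x r))%E}.
  apply: filterS mu_liminf => x.
  apply: (@ball_mass_lower_bound _ _ _ _ _ (fine (mu setT))) => //.
    exact: fine_ge0.
  move=> r r0; rewrite powRr0 mulr1 fineK ?fin_num_measure//.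
  by apply: le_measure; rewrite ?inE//; exact: measurable_itv.
split.
  rewrite [m * sigma]mulrC -{1}(subr0 m).
  by apply: upper_packing_dim_le => //; exact: bound_ge0.
move=> mu_neq0 delta delta0 mu_dim.
have mass_exponent a : 0 <= a < m -> a < delta ->
    {ae mu, forall x : R, exists A c : R, [/\ 0 <= A, 0 < c,
      forall r : R, 0 < r -> (mu (cball x r) <= (A * r `^ a)%:E)%E &
      \forall r \near 0^'+,
      ((c * r `^ (sigma * (m - a) / (m - sigma)))%:E <= mu (cball x r))%E]}.
  move=> a0m adelta; apply: filterS3 mu_liminf masses mu_dim.
  move=> x infJ [c c0 cmu] /(_ (mem_measure_support c0 cmu)) dimx.
  have {}dimx : \forall r \near 0^'+, (mu (cball x r) <= (r `^ a)%:E)%E.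
    by apply: lower_local_dim_mass dimx; rewrite lte_fin.
  have /andP[a0 am] := a0m.
  have [A A0 muA] := ball_mass_upper_bound a0 dimx.
  have [c' c'0 cmu'] := ball_mass_lower_bound ssm am A0 muA infJ.
  by exists A, c'.
(* This ensures that every [a < delta] also satisfies [a < m]. *)
have delta_le : delta <= m.
  rewrite leNgt; apply/negP => mdelta.
  (* For sigma < a < m the lower mass exponent sigma (m - a) / (m - sigma) is
     smaller than the upper one, a. *)
  pose a := (sigma + m) / 2.
  have am : a < m by rewrite /a; lra.
  have a0m : 0 <= a < m by rewrite am andbT /a; lra.
  (* As [mu] is nonzero, a property that holds almost everywhere holds at some point. *)
  have aePF : ProperFilter (almost_everywhere mu).
    by apply: ae_properfilter_algebraOfSetsType; rewrite lt0e mu_neq0 measure_ge0.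
  have [x [A [c [A0 c0 muA cmu]]]] :=
    filter_ex (mass_exponent a a0m (lt_trans am mdelta)).
  have := ball_mass_exponent_le c0 A0 cmu muA.
  rewrite ler_pdivlMr// /a; apply/negP; rewrite -ltNge; nra.
apply/lee_addgt0Pr => e e0; rewrite -EFinD.
(* The exponent for [a] exceeds the target by [sigma * (delta - a) / (m - sigma)], which this choice
   keeps at most [e]. The [+ 1] allows [sigma = 0]; the maximum ensures [0 <= a]. *)
pose a := Num.max 0 (delta - e * (m - sigma) / (sigma + 1)).
have s10 : 0 < sigma + 1 by lra.
have ee0 : 0 < e * (m - sigma) / (sigma + 1) by rewrite divr_gt0 ?mulr_gt0.
have adelta : a < delta by rewrite /a gt_max delta0 ltrBlDr ltrDl.
have am : a < m by exact: lt_le_trans delta_le.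
have a0m : 0 <= a < m by rewrite am le_max lexx.
apply: (@le_trans _ _ (sigma * (m - a) / (m - sigma))%:E).
  apply: upper_packing_dim_le; first exact: bound_ge0.
  apply: filterS (mass_exponent a a0m adelta) => x [A [c [_ c0 _ cmu]]].
  by exists c.
rewrite lee_fin ler_pdivrMr// mulrDl divfK ?gt_eqF//.
have : delta - e * (m - sigma) / (sigma + 1) <= a by rewrite le_max lexx orbT.
rewrite lerBlDr -lerBlDl ler_pdivlMr// => ae.
have : sigma * (delta - a) <= (delta - a) * (sigma + 1) by lra.
lra.
Qed.
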